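(* Let $G$ be a short dicotic game in misère dicotic canonical form. Then $G$ is invertible in the misère dicotic universe if and only if there is no follower $G'$ of $G$ (with $G$ itself counted as a follower of $G$) such that $G'+(-G')$ is a $\mathscr P$-position (previous player wins under misère play).
   Context: Games are short combinatorial games $G=\{G^{\mathcal L}\mid G^{\mathcal R}\}$ (finitely many distinct subpositions, no infinite run) under misère play (the last player to move loses). A game is dicotic if every subposition $G'$ satisfies $G'^{\mathcal L}=\emptyset$ iff $G'^{\mathcal R}=\emptyset$. A follower of $G$ is any position reachable from $G$, including $G$. Disjunctive sum: $G+H=\{G^{\mathcal L}+H,\,G+H^{\mathcal L}\mid G^{\mathcal R}+H,\,G+H^{\mathcal R}\}$; conjugate: $-G=\{-G^{\mathcal R}\mid -G^{\mathcal L}\}$ recursively. Outcome classes: $\mathscr L$ (Left wins moving first or second), $\mathscr R$ (Right wins either way), $\mathscr N$ (next player wins), $\mathscr P$ (previous player wins), ordered $\mathscr L>\mathscr P,\mathscr N>\mathscr R$. Let $\mathcal D^-$ be the class of short dicotic games under misère play; for $G,H\in\mathcal D^-$, $G\succcurlyeq H$ iff $o(G+X)\ge o(H+X)$ for all $X\in\mathcal D^-$, and $G=H$ iff $o(G+X)=o(H+X)$ for all $X\in\mathcal D^-$. $G$ is invertible if there is $H\in\mathcal D^-$ with $G+H=0$ (where $0=\{\,\mid\,\}$). Canonical form: a dicotic form is in canonical form if none of the following reductions (all preserving equality modulo $\mathcal D^-$) can be applied to it or to any of its followers to change its sets of options: (i) removing a dominated option (a left option $A$ with $A\preccurlyeq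 B$ for another left option $B$, and dually for Right); (ii) non-atomic reversibility: if $A\in G^{\mathcal L}$ has a right option $B\preccurlyeq G$ with $B^{\mathcal L}\neq\emptyset$, replace $A$ by the left options of $B$ (dually for Right); (iii) atomic reversibility: if $A\in G^{\mathcal L}$ has a right option $B=0$ with $B\preccurlyeq G$ (B left-atomic), remove $A$ if Left has another winning first move in $G$, and otherwise replace $A$ by $*=\{0\mid 0\}$ (dually for Right); (iv) substitution: if $G=\{A\mid C\}$ with $A$, $C$ atomic-reversible, replace $G$ by $0$. Canonical forms in $\mathcal D^-$ are unique. *)

(* Defs.v *)
From HB Require Import structures.
From mathcomp Require Import all_boot.

Set Implicit Arguments.
Unset Strict Implicit.
Unset Printing Implicit Defensive.

(* Short games. A node carries finite lists of options, which represent the   *)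
(* option *sets*: order and repetitions are irrelevant, and two lists-of-     *)
(* options trees denote the same form exactly when they are related by [same] *)
(* below (hereditary set equality).                                           *)
Inductive game : Type := Game of seq game & seq game.

Definition lopts (G : game) : seq game := let: Game L _ := G in L.
Definition ropts (G : game) : seq game := let: Game _ R := G in R.

(* Coq's generated principle has no hypothesis for the nested lists. *)
Fixpoint game_nested_ind (P : game -> Prop)
    (H : forall L R, foldr (fun X => and (P X)) True L ->
                     foldr (fun X => and (P X)) True R -> P (Game L R))
    (G : game) : P G :=
  let fix loop (s : seq game) : foldr (fun X => and (P X)) True s :=
    if s is X :: s' then conj (game_nested_ind H X) (loop s') else I in
  let: Game L R := G in H L R (loop L) (loop R).

(* Countable structure (hence syntactic equality and \in) via generic trees. *)
Fixpoint game_encode (G : game) : GenTree.tree void :=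
  let: Game L R := G in
  GenTree.Node 0 [:: GenTree.Node 0 (map game_encode L);
                     GenTree.Node 0 (map game_encode R)].

Fixpoint game_decode (t : GenTree.tree void) : game :=
  match t with
  | GenTree.Node _ [:: GenTree.Node _ l; GenTree.Node _ r] =>
      Game (map game_decode l) (map game_decode r)
  | _ => Game [::] [::]
  end.

Lemma game_encodeK : cancel game_encode game_decode.
Proof.
elim/game_nested_ind=> L R hL hR /=; congr Game.
  by elim: L hL => //= X s IHs [-> /IHs ->].
by elim: R hR => //= X s IHs [-> /IHs ->].
Qed.

HB.instance Definition _ := Countable.copy game (can_type game_encodeK).

Fixpoint same (G H : game) {struct G} : bool :=
  let: Game L R := G in
  let: Game L' R' := H in
  [&& all (fun X => has (fun Y => same X Y) L') L,
      all (fun Y => has (fun X => same X Y) L) L',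
      all (fun X => has (fun Y => same X Y) R') R
    & all (fun Y => has (fun X => same X Y) R) R'].

Definition zero : game := Game [::] [::].
Definition star : game := Game [:: zero] [:: zero].

Fixpoint gadd (G : game) : game -> game :=
  fix gaddG (H : game) : game :=
    Game (map (fun X => gadd X H) (lopts G) ++ map gaddG (lopts H))
         (map (fun X => gadd X H) (ropts G) ++ map gaddG (ropts H)).

Fixpoint gneg (G : game) : game :=
  let: Game L R := G in Game (map gneg R) (map gneg L).

(* Positions reachable by any sequence of moves, not necessarily alternating. *)
Inductive follower (G : game) : game -> Prop :=
| follower_refl : follower G G
| follower_left F X : follower G F -> X \in lopts F -> follower G X
| follower_right F X : follower G F -> X \in ropts F -> follower G X.

Definition dicotic (G : game) : Prop :=
  forall F, follower G F -> (lopts F = [::] <-> ropts F = [::]).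

Inductive player := Left | Right.
Definition opponent (p : player) : player :=
  if p is Left then Right else Left.

(* [p] wins moving first under misere play: a player unable to move wins. *)
Fixpoint wins_first (p : player) (G : game) {struct G} : bool :=
  let: Game L R := G in
  let s := match p with Left => L | Right => R end in
  nilp s || has (fun X => ~~ wins_first (opponent p) X) s.

Inductive outcome_class := OL | OP | ON | OR.

Definition outcome (G : game) : outcome_class :=
  match wins_first Left G, wins_first Right G with
  | true, false => OL
  | true, true => ON
  | false, false => OP
  | false, true => OR
  end.

(* The partial order L > P, N > R, with P and N incomparable. *)
Definition outcome_ge (a b : outcome_class) : bool :=
  match a, b with
  | OL, _ | _, OR | OP, OP | ON, ON => true
  | _, _ => false
  end.

Definition dge (G H : game) : Prop :=
  forall X, dicotic X -> outcome_ge (outcome (gadd G X)) (outcome (gadd H X)).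

Definition deq (G H : game) : Prop :=
  forall X, dicotic X -> outcome (gadd G X) = outcome (gadd H X).

Definition invertible (G : game) : Prop :=
  exists H, dicotic H /\ deq (gadd G H) zero.

(* Set difference: drops every list entry denoting the same form as [A]. *)
Definition remove (A : game) (s : seq game) : seq game :=
  [seq X <- s | ~~ same X A].

(* [A] is reversible through the atom 0 as a left (resp. right) option of G. *)
Definition latomic_rev (G A : game) : Prop := zero \in ropts A /\ dge G zero.
Definition ratomic_rev (G C : game) : Prop := zero \in lopts C /\ dge zero G.

Inductive reduces (G : game) : game -> Prop :=
| dominated_left A B :
    A \in lopts G -> B \in lopts G -> ~~ same A B -> dge B A ->
    reduces G (Game (remove A (lopts G)) (ropts G))
| dominated_right A B :
    A \in ropts G -> B \in ropts G -> ~~ same A B -> dge A B ->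
    reduces G (Game (lopts G) (remove A (ropts G)))
| nonatomic_left A B :
    A \in lopts G -> B \in ropts A -> dge G B -> lopts B <> [::] ->
    reduces G (Game (lopts B ++ remove A (lopts G)) (ropts G))
| nonatomic_right A B :
    A \in ropts G -> B \in lopts A -> dge B G -> ropts B <> [::] ->
    reduces G (Game (lopts G) (ropts B ++ remove A (ropts G)))
| atomic_left A :
    A \in lopts G -> latomic_rev G A ->
    reduces G
      (Game (if has (fun X => ~~ wins_first Right X) (remove A (lopts G))
             then remove A (lopts G) else star :: remove A (lopts G))
            (ropts G))
| atomic_right A :
    A \in ropts G -> ratomic_rev G A ->
    reduces G
      (Game (lopts G)
            (if has (fun X => ~~ wins_first Left X) (remove A (ropts G))
             then remove A (ropts G) else star :: remove A (ropts G)))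
| substitution A C :
    same G (Game [:: A] [:: C]) -> latomic_rev G A -> ratomic_rev G C ->
    reduces G zero.

(* A reduction may apply as long as it leaves the option sets unchanged:      *)
(* replacing the atomic-reversible option * by * does not break               *)
(* canonicity.                                                                *)
Definition canonical (G : game) : Prop :=
  forall F F', follower G F -> reduces F F' -> same F' F.

(* Main.v *)
Require Import Defs.
From mathcomp Require Import all_boot.
From Stdlib Require Import Classical.

(** If no follower [F] of [G] has [F - F] in P, then [G - G >= 0]: Left mirrors
    Right's moves, and the outcome of [G - G], which is N or P by symmetry,
    supplies the proviso of the comparison test.  The symmetric argument gives
    [G - G <= 0], so [-G] is an inverse.

    Conversely let [G + H = 0].  If [J <= 0], then after any Left move in [J]
    Right can restore [<= 0] (otherwise a test game built from adjoints tells
    [J] and [0] apart).  Answering a Left move of [G] in [G + H] therefore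
    shows that this option is either reversible, hence [*] by canonicity, or
    dominated by an option with the same partial inverse, hence invertible by
    canonicity.  By induction the proper followers satisfy [F - F = 0]; then
    [G + K <= 0] implies [K <= -G] for every [K], so [G - G >= G + H = 0] and
    [G - G] is not in P. *)

Set Implicit Arguments.
Unset Strict Implicit.
Unset Printing Implicit Defensive.

Declare Scope game_scope.
Local Notation "G + H" := (gadd G H) : game_scope.
Local Notation "- G" := (gneg G) : game_scope.
Local Notation "G - H" := (gadd G (gneg H)) : game_scope.
Local Open Scope game_scope.

Lemma nilp_map (T U : Type) (f : T -> U) s : nilp (map f s) = nilp s.
Proof. by rewrite /nilp size_map. Qed.

(** * Options and outcomes *)

Lemma opponentK : involutive opponent. Proof. by case. Qed.

Definition opts (p : player) (G : game) : seq game :=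
  if p is Left then lopts G else ropts G.

Definition mkgame (p : player) (s t : seq game) : game :=
  if p is Left then Game s t else Game t s.

Lemma opts_mkgame p s t : opts p (mkgame p s t) = s.
Proof. by case: p. Qed.

Lemma opts_mkgame_opponent p s t : opts (opponent p) (mkgame p s t) = t.
Proof. by case: p. Qed.

Lemma opts_zero p : opts p zero = [::].
Proof. by case: p. Qed.

Lemma opts_star p : opts p star = [:: zero].
Proof. by case: p. Qed.

Lemma eq_from_opts G H : (forall p, opts p G = opts p H) -> G = H.
Proof.
by case: G H => L R [L' R'] eqo; rewrite (eqo Left : L = _) (eqo Right : R = _).
Qed.

Lemma game_opts_ind (P : game -> Prop) :
  (forall G, (forall p X, X \in opts p G -> P X) -> P G) -> forall G, P G.
Proof.
have inP s : foldr (fun X => and (P X)) True s -> forall X, X \in s -> P X.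
  by elim: s => // Y s IHs [PY /IHs Ps] X; rewrite inE => /predU1P[->|/Ps].
move=> IH; elim/game_nested_ind=> L R PL PR; apply: IH => -[] X /=.
  exact: inP PL X.
exact: inP PR X.
Qed.

Lemma game_opts2_ind (P : game -> Prop) :
  (forall G, (forall p q X Y, X \in opts p G -> Y \in opts q X -> P Y) ->
     P G) ->
  forall G, P G.
Proof.
move=> IH G; suff [] : P G /\ forall p X, X \in opts p G -> P X by [].
elim/game_opts_ind: G => G IHG; split=> [|p X XG]; last exact: (IHG p X XG).1.
by apply: IH => p q X Y XG; apply: (IHG p X XG).2.
Qed.

Lemma wins_firstE p G :
  wins_first p G =
  nilp (opts p G) || has (fun X => ~~ wins_first (opponent p) X) (opts p G).
Proof. by case: G => L R; case: p. Qed.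

Lemma wins_firstP p G :
  reflect (opts p G = [::] \/
           exists2 X, X \in opts p G & ~~ wins_first (opponent p) X)
          (wins_first p G).
Proof.
by rewrite wins_firstE; apply: (iffP orP) => -[/nilP|/hasP]; tauto.
Qed.

Lemma wins_first_opt p G X :
  X \in opts p G -> ~~ wins_first (opponent p) X -> wins_first p G.
Proof. by move=> XG nX; apply/wins_firstP; right; exists X. Qed.

Lemma wins_first_zero p : wins_first p zero.
Proof. by case: p. Qed.

Lemma loses_firstP p G :
  reflect (opts p G <> [::] /\
           forall X, X \in opts p G -> wins_first (opponent p) X)
          (~~ wins_first p G).
Proof.
apply: (iffP idP) => [nG | [optsG winX]].
  split=> [nilG | X XG]; first by move/wins_firstP: nG; apply; left.
  by apply: contraNT nG; apply: wins_first_opt.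
by apply/wins_firstP=> -[//|[X /winX -> //]].
Qed.

(** * Sums and conjugates *)

Lemma opts_gadd p G H :
  opts p (G + H) = map (gadd^~ H) (opts p G) ++ map (gadd G) (opts p H).
Proof. by case: G => L R; case: H => L' R'; case: p. Qed.

Lemma mem_opts_gadd p G H X : X \in opts p (G + H) ->
  (exists2 A, A \in opts p G & X = A + H) \/
  (exists2 B, B \in opts p H & X = G + B).
Proof.
by rewrite opts_gadd mem_cat => /orP[] /mapP[Y]; [left|right]; exists Y.
Qed.

Lemma opts_gadd_nil p G H :
  opts p (G + H) = [::] <-> opts p G = [::] /\ opts p H = [::].
Proof.
rewrite opts_gadd.
by case: (opts p G) (opts p H) => [|? ?] [|? ?]; split=> // -[].
Qed.

Lemma opts_gaddl p G H A : A \in opts p G -> A + H \in opts p (G + H).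
Proof. by move=> AG; rewrite opts_gadd mem_cat (map_f (gadd^~ H) AG). Qed.

Lemma opts_gaddr p G H B : B \in opts p H -> G + B \in opts p (G + H).
Proof. by move=> BH; rewrite opts_gadd mem_cat (map_f (gadd G) BH) orbT. Qed.

Lemma gadd0g : left_id zero gadd.
Proof.
elim/game_opts_ind=> G IH; apply: eq_from_opts => p.
by rewrite opts_gadd opts_zero /= map_id_in // => X; apply: IH.
Qed.

Lemma gaddg0 : right_id zero gadd.
Proof.
elim/game_opts_ind=> G IH; apply: eq_from_opts => p.
by rewrite opts_gadd opts_zero cats0 map_id_in // => X; apply: IH.
Qed.

Lemma gaddA : associative gadd.
Proof.
elim/game_opts_ind=> G IHG; elim/game_opts_ind=> H IHH.
elim/game_opts_ind=> K IHK; apply: eq_from_opts => p.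
rewrite !opts_gadd !map_cat -!map_comp -catA; congr (_ ++ (_ ++ _)).
- by apply/eq_in_map => X XG /=; rewrite (IHG p).
- by apply/eq_in_map => X XH /=; rewrite (IHH p).
by apply/eq_in_map => X XK /=; rewrite (IHK p).
Qed.

Lemma opts_gneg p G : opts p (- G) = map gneg (opts (opponent p) G).
Proof. by case: G => L R; case: p. Qed.

Lemma gneg_eq0 G : - G = zero -> G = zero.
Proof. by case: G => [[|A L] [|B R]]. Qed.

Lemma gnegK : involutive gneg.
Proof.
elim/game_opts_ind=> G IH; apply: eq_from_opts => p.
by rewrite !opts_gneg opponentK -map_comp map_id_in // => X; apply: IH.
Qed.

Lemma gneg_gadd G H : - (G + H) = - G - H.
Proof.
elim/game_opts_ind: G H => G IHG; elim/game_opts_ind=> H IHH.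
apply: eq_from_opts => p.
rewrite opts_gneg !opts_gadd !opts_gneg map_cat -!map_comp.
congr (_ ++ _); apply/eq_in_map => X XG /=; first exact: IHG XG _.
exact: IHH XG.
Qed.

Lemma wins_first_gneg p G : wins_first p (- G) = wins_first (opponent p) G.
Proof.
elim/game_opts_ind: G p => G IH p.
rewrite !wins_firstE opts_gneg nilp_map.
congr (_ || _); rewrite has_map; apply: eq_in_has => X XG /=.
by rewrite (IH _ X XG).
Qed.

(** * Equality of forms *)

Lemma sameP G H :
  reflect (forall p,
    (forall X, X \in opts p G -> exists2 Y, Y \in opts p H & same X Y) /\
    (forall Y, Y \in opts p H -> exists2 X, X \in opts p G & same X Y))
  (same G H).
Proof.
case: G H => [L R] [L' R'] /=; apply: (iffP and4P) => [[] | match_opts].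
  move=> /allP LL' /allP L'L /allP RR' /allP R'R.
  by case; split=> X /=; [move/LL' | move/L'L | move/RR' | move/R'R] => /hasP.
have [LL' L'L] := match_opts Left; have [RR' R'R] := match_opts Right.
split; apply/allP=> X Xin; apply/hasP.
- exact: LL'.
- exact: L'L.
- exact: RR'.
exact: R'R.
Qed.

Lemma same_opt p G H X :
  same G H -> X \in opts p G -> exists2 Y, Y \in opts p H & same X Y.
Proof. by move=> /sameP/(_ p)[GH _]; apply: GH. Qed.

Lemma same_sym G H : same G H -> same H G.
Proof.
elim/game_opts_ind: G H => G IH H /sameP sGH; apply/sameP=> p.
have [GH HG] := sGH p; split=> [Y /HG[X XG sXY] | X XG].
  by exists X => //; apply: IH XG _ sXY.
by have [Y YH sXY] := GH X XG; exists Y => //; apply: IH XG _ sXY.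
Qed.

Lemma same_bisim (E : game -> game -> Prop) :
  (forall G H, E G H -> E H G) ->
  (forall G H p X, E G H -> X \in opts p G ->
     exists2 Y, Y \in opts p H & E X Y) ->
  forall G H, E G H -> same G H.
Proof.
move=> symE stepE; elim/game_opts_ind=> G IH H EGH; apply/sameP=> p.
split=> [X XG | Y YH].
  have [Y YH EXY] := stepE _ _ _ _ EGH XG.
  by exists Y => //; apply: IH XG _ EXY.
have [X XG /symE EXY] := stepE _ _ _ _ (symE _ _ EGH) YH.
by exists X => //; apply: IH XG _ EXY.
Qed.

Lemma same_refl G : same G G.
Proof.
by apply: (@same_bisim eq) => // {}G _ p X <- XG; exists X.
Qed.

Lemma same_gadd G G' H H' : same G G' -> same H H' -> same (G + H) (G' + H').
Proof.
move=> sG sH; pose E X Y := exists A A' B B',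
  [/\ X = A + B, Y = A' + B', same A A' & same B B'].
apply: (@same_bisim E); last by exists G, G', H, H'.
  move=> _ _ [A [A' [B [B' [-> -> sA sB]]]]].
  by exists A', A, B', B; split=> //; apply: same_sym.
move=> _ _ p _ [A [A' [B [B' [-> -> sA sB]]]]] /mem_opts_gadd[] [C CX ->].
  have [C' C'A' sC] := same_opt sA CX.
  by exists (C' + B'); [apply: opts_gaddl | exists C, C', B, B'].
have [C' C'B' sC] := same_opt sB CX.
by exists (A' + C'); [apply: opts_gaddr | exists A, A', C, C'].
Qed.

Lemma same_gaddC G H : same (G + H) (H + G).
Proof.
apply: (@same_bisim (fun X Y => exists A B, X = A + B /\ Y = B + A)).
- by move=> _ _ [A [B [-> ->]]]; exists B, A.
- move=> _ _ p _ [A [B [-> ->]]] /mem_opts_gadd[] [C CX ->].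
    by exists (B + C); [apply: opts_gaddr | exists C, B].
  by exists (C + A); [apply: opts_gaddl | exists A, C].
by exists G, H.
Qed.

Lemma same_gneg G H : same G H -> same (- G) (- H).
Proof.
move=> sGH.
apply: (@same_bisim (fun X Y => exists A B, [/\ X = - A, Y = - B & same A B])).
- by move=> _ _ [A [B [-> -> /same_sym sBA]]]; exists B, A.
- move=> _ _ p X [A [B [-> -> sAB]]]; rewrite !opts_gneg => /mapP[C CA ->].
  have [D DB sCD] := same_opt sAB CA.
  by exists (- D); [apply: map_f | exists C, D].
by exists G, H.
Qed.

Lemma same_opts_nil p G H : same G H -> opts p G = [::] -> opts p H = [::].
Proof.
move=> /same_sym sHG nilG; case E: (opts p H) => [//|X s].
by have [|Y] := same_opt sHG (_ : X \in opts p H); rewrite ?nilG // E mem_head.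
Qed.

Lemma same_zero G : same G zero -> G = zero.
Proof.
move=> /same_sym s0G; apply: eq_from_opts => p.
by rewrite (same_opts_nil s0G) ?opts_zero.
Qed.

Lemma same_wins_first p G H : same G H -> wins_first p G = wins_first p H.
Proof.
elim/game_opts_ind: G H p => G IH H p sGH; apply/wins_firstP/wins_firstP.
  case=> [nilG | [X XG nX]]; first by left; apply: same_opts_nil nilG.
  have [Y YH sXY] := same_opt sGH XG.
  by right; exists Y; rewrite // -(IH p X XG Y).
have sHG := same_sym sGH.
case=> [nilH | [Y YH nY]]; first by left; apply: same_opts_nil nilH.
have [X XG /same_sym sXY] := same_opt sHG YH.
by right; exists X; rewrite // (IH p X XG Y).
Qed.

Lemma same_outcome G H : same G H -> outcome G = outcome H.
Proof. by move=> sGH; rewrite /outcome !(same_wins_first _ sGH). Qed.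

Lemma same_opts2F p q G X Y :
  X \in opts p G -> Y \in opts q X -> same Y G = false.
Proof.
elim/game_opts2_ind: G p q X Y => G IH p q X Y XG YX; apply/negP => sYG.
have [X' X'Y sXX'] := same_opt (same_sym sYG) XG.
have [Y' Y'X' /same_sym sY'Y] := same_opt sXX' YX.
by have := IH _ _ _ _ XG YX _ _ _ _ X'Y Y'X'; rewrite sY'Y.
Qed.

Lemma wins_first_gaddC p G H : wins_first p (G + H) = wins_first p (H + G).
Proof. exact: same_wins_first (same_gaddC G H). Qed.

Lemma wins_first_gadd_gneg p G :
  wins_first p (G - G) = wins_first (opponent p) (G - G).
Proof. by rewrite -wins_first_gneg gneg_gadd gnegK wins_first_gaddC. Qed.

Lemma outcome_gadd_gneg_not_P p G :
  outcome (G - G) <> OP <-> wins_first p (G - G).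
Proof.
have := wins_first_gadd_gneg Left G.
by rewrite /outcome; case: p => /= <-; case: (wins_first Left _).
Qed.

(** * Followers and dicotic games *)

Lemma follower_step p G F X : follower G F -> X \in opts p F -> follower G X.
Proof.
by case: p => /= GF XF; [apply: follower_left XF | apply: follower_right XF].
Qed.

Lemma follower_opt p G X : X \in opts p G -> follower G X.
Proof. exact: follower_step (follower_refl G). Qed.

Lemma follower_trans G F K : follower G F -> follower F K -> follower G K.
Proof.
move=> GF; elim=> // {K} [K X _ GK XK | K X _ GK XK].
  exact: (@follower_step Left) GK XK.
exact: (@follower_step Right) GK XK.
Qed.

Lemma follower_cases G F :
  follower G F -> F = G \/ exists p, exists2 X, X \in opts p G & follower X F.
Proof.
pose cases K := K = G \/ exists p, exists2 X, X \in opts p G & follower X K.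
have step p K X : cases K -> X \in opts p K -> cases X.
  case=> [-> | [q [Y YG YK]]] XK; right.
    by exists p, X => //; apply: follower_refl.
  by exists q, Y => //; apply: follower_step XK.
elim=> [|K X _ IH XK|K X _ IH XK]; first by left.
  exact: (step Left) XK.
exact: (step Right) XK.
Qed.

Lemma dicotic_follower G F : dicotic G -> follower G F -> dicotic F.
Proof. by move=> dG GF K FK; apply: dG; apply: follower_trans FK. Qed.

Lemma dicotic_opt p G X : dicotic G -> X \in opts p G -> dicotic X.
Proof. by move=> dG XG; apply: dicotic_follower dG (follower_opt XG). Qed.

Lemma dicotic_nilp G : dicotic G -> nilp (opts Left G) = nilp (opts Right G).
Proof.
by move=> dG; have [nilR nilL] := dG _ (follower_refl G); apply/nilP/nilP.
Qed.

Lemma dicotic_opts_nil p G : dicotic G -> opts p G = [::] -> G = zero.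
Proof.
move=> /dicotic_nilp nilLR /nilP nilG.
have nil_opts q : opts q G = [::].
  by apply/nilP; case: p q nilG => -[]; rewrite ?nilLR.
by apply: eq_from_opts => q; rewrite opts_zero.
Qed.

Lemma dicoticI G : nilp (opts Left G) = nilp (opts Right G) ->
  (forall p X, X \in opts p G -> dicotic X) -> dicotic G.
Proof.
move=> nilLR dopts F /follower_cases[-> | [p [X XG XF]]].
  by split=> /nilP; [rewrite nilLR | rewrite -nilLR] => /nilP.
exact: dicotic_follower (dopts p X XG) XF _ (follower_refl F).
Qed.

Lemma dicotic_mkgame p A s B t :
  {in A :: s, forall X, dicotic X} -> {in B :: t, forall X, dicotic X} ->
  dicotic (mkgame p (A :: s) (B :: t)).
Proof.
move=> ds dt; apply: dicoticI; first by case: p.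
by case: p => -[] X /=; by [apply: ds | apply: dt].
Qed.

Lemma dicotic_zero : dicotic zero.
Proof. by apply: dicoticI => // p X; rewrite opts_zero. Qed.

Lemma dicotic_star : dicotic star.
Proof.
by apply: (@dicotic_mkgame Left) => X; rewrite mem_seq1 => /eqP->;
  apply: dicotic_zero.
Qed.

Lemma dicotic_gadd G H : dicotic G -> dicotic H -> dicotic (G + H).
Proof.
elim/game_opts_ind: G H => G IHG; elim/game_opts_ind=> H IHH dG dH.
apply: dicoticI => [|p X /mem_opts_gadd[] [A AX ->]].
- by rewrite !opts_gadd !cat_nilp !nilp_map !dicotic_nilp.
- exact: IHG AX _ (dicotic_opt dG AX) dH.
exact: IHH AX dG (dicotic_opt dH AX).
Qed.

Lemma dicotic_gneg G : dicotic G -> dicotic (- G).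
Proof.
elim/game_opts_ind: G => G IH dG; apply: dicoticI => [|p X].
  by rewrite !opts_gneg !nilp_map; apply/esym/dicotic_nilp.
by rewrite opts_gneg => /mapP[Y YG ->]; apply: IH YG (dicotic_opt dG YG).
Qed.

(** * The order modulo dicotic games *)

(* [G >=[Left] H] is [G >= H] and [G >=[Right] H] is [G <= H]. *)
Definition pge (p : player) (G H : game) : Prop :=
  forall X, dicotic X ->
    (wins_first p (H + X) -> wins_first p (G + X)) /\
    (wins_first (opponent p) (G + X) -> wins_first (opponent p) (H + X)).

Local Notation "G >=[ p ] H" := (pge p G H)
  (at level 70, no associativity, format "G  >=[ p ]  H") : game_scope.

Lemma pge_opponent p G H : G >=[opponent p] H <-> H >=[p] G.
Proof. by split=> ge X /ge[]; rewrite opponentK. Qed.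

Lemma dge_pge_left G H : dge G H <-> G >=[Left] H.
Proof.
split=> ge X dX; have := ge X dX; rewrite /outcome /=;
  do 4!case: (wins_first _ _) => //=; by [split; auto | case; auto].
Qed.

Lemma dge_pge_right G H : dge G H <-> H >=[Right] G.
Proof.
by rewrite dge_pge_left; apply: iff_sym; apply: (pge_opponent Left).
Qed.

Lemma deq_pge p G H : deq G H <-> G >=[p] H /\ H >=[p] G.
Proof.
split=> [eqGH | [GH HG] X dX].
  by split=> X /eqGH; rewrite /outcome; case: p => /=;
    do 4!case: (wins_first _ _) => //=; auto.
have [GHp GHo] := GH X dX; have [HGp HGo] := HG X dX.
have winp : wins_first p (G + X) = wins_first p (H + X) by apply/idP/idP.
have wino : wins_first (opponent p) (G + X) = wins_first (opponent p) (H + X).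
  by apply/idP/idP.
by rewrite /outcome; case: (p) winp wino => /= -> ->.
Qed.

Lemma pge_trans p H G K : G >=[p] H -> H >=[p] K -> G >=[p] K.
Proof. by move=> GH HK X dX; have := GH X dX; have := HK X dX; tauto. Qed.

Lemma pge_same p G H : same G H -> G >=[p] H.
Proof.
by move=> sGH X _; rewrite !(same_wins_first _ (same_gadd sGH (same_refl X))).
Qed.

Lemma pge_gaddC p G H : G + H >=[p] H + G.
Proof. exact: pge_same (same_gaddC G H). Qed.

Lemma pge_gadd2r p G H K : dicotic K -> G >=[p] H -> G + K >=[p] H + K.
Proof. by move=> dK GH X dX; rewrite -!gaddA; apply/GH/dicotic_gadd. Qed.

Lemma pge_gadd2l p G H K : dicotic K -> G >=[p] H -> K + G >=[p] K + H.
Proof.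
move=> dK GH; apply: pge_trans (pge_gaddC _ _ _) _.
exact: pge_trans (pge_gadd2r dK GH) (pge_gaddC _ _ _).
Qed.

(* A <= A + (B + K) = (A + K) + B <= B *)
Lemma pge_cancel p A B K : dicotic A -> dicotic B ->
  zero >=[p] A + K -> B + K >=[p] zero -> B >=[p] A.
Proof.
move=> dA dB /(pge_gadd2r dB) + /(pge_gadd2l dA).
rewrite gadd0g gaddg0 -gaddA => B_ge A_le.
apply: pge_trans B_ge _; apply: pge_trans A_le.
exact: pge_same (same_gadd (same_refl A) (same_gaddC _ _)).
Qed.

Lemma pge_zero_wins_first p G : G >=[p] zero -> wins_first p G.
Proof.
case/(_ zero dicotic_zero); rewrite !gaddg0 => winG _.
exact/winG/wins_first_zero.
Qed.

Lemma zero_pge_wins_first p G : zero >=[p] G -> wins_first (opponent p) G.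
Proof. by move/pge_opponent; apply: pge_zero_wins_first. Qed.

Definition dominated (p : player) (G A : game) : Prop :=
  exists2 B, B \in opts p G & B >=[p] A.

Definition reversible (p : player) (G A : game) : Prop :=
  exists2 C, C \in opts (opponent p) A & G >=[p] C.

(* One player's half of the comparison test for [G >=[p] H]; the condition at
   zero is the proviso that misere play adds. *)
Definition covers (p : player) (G H : game) : Prop :=
  (H = zero -> wins_first p G) /\
  forall A, A \in opts p H -> dominated p G A \/ reversible p G A.

Lemma covers_wins_first p G H X : dicotic H -> dicotic X -> covers p G H ->
  (forall Y, Y \in opts p X ->
     wins_first (opponent p) (G + Y) -> wins_first (opponent p) (H + Y)) ->
  wins_first p (H + X) -> wins_first p (G + X).
Proof.
move=> dH dX [winG coverH] winGY /wins_firstP[/opts_gadd_nil[nilH nilX] | [Z]].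
  rewrite (dicotic_opts_nil dX nilX) gaddg0.
  exact/winG/(dicotic_opts_nil dH nilH).
case/mem_opts_gadd=> -[A AY ->] nA; last first.
  by apply: wins_first_opt (opts_gaddr G AY) _; apply: contra nA; apply: winGY.
have [[B BG BA] | [C CA GC]] := coverH A AY.
  apply: wins_first_opt (opts_gaddl X BG) _.
  by apply: contra nA; apply: (BA X dX).2.
have [_ /(_ _ (opts_gaddl X CA))] := loses_firstP _ _ nA.
by rewrite opponentK; apply: (GC X dX).1.
Qed.

Lemma covers_pge p G H : dicotic G -> dicotic H ->
  covers p G H -> covers (opponent p) H G -> G >=[p] H.
Proof.
move=> dG dH cGH cHG; elim/game_opts_ind=> X IH dX.
have IHX q Y (YX : Y \in opts q X) := IH q Y YX (dicotic_opt dX YX).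
split; apply: covers_wins_first => // Y YX; first exact: (IHX _ Y YX).2.
by rewrite opponentK; apply: (IHX _ Y YX).1.
Qed.

(** * Test games *)

Fixpoint adjoint (G : game) : game :=
  let: Game L R := G in
  if nilp L && nilp R then star else Game (map adjoint R) (map adjoint L).

Lemma opts_adjoint p G : G <> zero ->
  opts p (adjoint G) = map adjoint (opts (opponent p) G).
Proof. by case: G p => [[|A L] [|B R]] []. Qed.

Lemma dicotic_adjoint G : dicotic G -> dicotic (adjoint G).
Proof.
elim/game_opts_ind: G => G IH dG.
have [-> | /eqP nz] := eqVneq G zero; first exact: dicotic_star.
apply: dicoticI => [|p X]; rewrite !opts_adjoint //.
  by rewrite !nilp_map; apply/esym/dicotic_nilp.
by move=> /mapP[Y YG ->]; apply: IH YG (dicotic_opt dG YG).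
Qed.

Lemma adjoint_loses_first p G : dicotic G -> ~~ wins_first p (G + adjoint G).
Proof.
elim/game_opts_ind: G p => G IH p dG.
have [-> | /eqP nz] := eqVneq G zero; first by case: p.
have lose q A : A \in opts q G ->
    ~~ wins_first (opponent (opponent p)) (A + adjoint A).
  by move=> AG; apply: IH AG _ (dicotic_opt dG AG).
apply/loses_firstP; split=> [/opts_gadd_nil[/(dicotic_opts_nil dG)] // | X].
case/mem_opts_gadd=> -[A AX ->].
  apply: wins_first_opt (lose _ _ AX); apply: opts_gaddr.
  by rewrite opts_adjoint // opponentK map_f.
move: AX; rewrite opts_adjoint // => /mapP[B BG ->].
by apply: wins_first_opt (lose _ _ BG); apply: opts_gaddl.
Qed.

Definition waiting_test (p : player) (C X : game) : game :=
  mkgame p (zero :: map adjoint (opts (opponent p) C)) [:: X].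

Lemma dicotic_waiting_test p C X :
  dicotic C -> dicotic X -> dicotic (waiting_test p C X).
Proof.
move=> dC dX; apply: dicotic_mkgame => Y; last by rewrite mem_seq1 => /eqP->.
rewrite inE => /predU1P[-> | /mapP[Z ZC ->]]; first exact: dicotic_zero.
exact: dicotic_adjoint (dicotic_opt dC ZC).
Qed.

Lemma waiting_test_wins_first p C X :
  ~~ wins_first p X -> wins_first (opponent p) (waiting_test p C X).
Proof.
move=> nX; apply: (@wins_first_opt _ _ X); last by rewrite opponentK.
by rewrite opts_mkgame_opponent mem_head.
Qed.

Lemma waiting_test_loses_first p C X : dicotic C ->
  wins_first p (C + X) -> ~~ wins_first (opponent p) (C + waiting_test p C X).
Proof.
move=> dC winCX; apply/loses_firstP; rewrite opponentK; split.
  by case/opts_gadd_nil; rewrite opts_mkgame_opponent.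
move=> Y /mem_opts_gadd[] [A AC ->]; last first.
  by move: AC; rewrite opts_mkgame_opponent inE => /eqP->.
apply: wins_first_opt (adjoint_loses_first (opponent p) (dicotic_opt dC AC)).
by apply: opts_gaddr; rewrite opts_mkgame inE map_f ?orbT.
Qed.

(* A test separating 0 from [C] may do so with the wrong player to move; the
   waiting move of [waiting_test] then passes the turn. *)
Lemma not_zero_pge_test p C : dicotic C -> ~ zero >=[p] C ->
  exists2 Y, dicotic Y &
    wins_first (opponent p) Y /\ ~~ wins_first (opponent p) (C + Y).
Proof.
move=> dC nge; apply: NNPP => no_test; apply: nge => X dX.
rewrite gadd0g; split=> win; apply: contraT => lose; case: no_test;
  last by exists X.
exists (waiting_test p C X); first exact: dicotic_waiting_test.
by split; [apply: waiting_test_wins_first | apply: waiting_test_loses_first].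
Qed.

(* The options [t] refute the opponent's replies in [A] and [adjoint A] a reply
   in the test itself; [zero] keeps the test dicotic when [t] is empty. *)
Definition response_test (p : player) (A : game) (t : seq game) : game :=
  mkgame p (zero :: t) [:: mkgame p [:: adjoint A] [:: zero]].

Lemma dicotic_response_test p A t : dicotic A ->
  {in t, forall Y, dicotic Y} -> dicotic (response_test p A t).
Proof.
move=> dA dt; apply: dicotic_mkgame => Y.
  by rewrite inE => /predU1P[-> | /dt //]; apply: dicotic_zero.
rewrite mem_seq1 => /eqP->.
apply: dicotic_mkgame => Z; rewrite mem_seq1 => /eqP->.
  exact: dicotic_adjoint.
exact: dicotic_zero.
Qed.

Lemma response_test_loses_first p A t :
  {in t, forall Y, wins_first (opponent p) Y} ->
  ~~ wins_first p (response_test p A t).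
Proof.
move=> wint; apply/loses_firstP; rewrite opts_mkgame; split=> // Y.
by rewrite inE => /predU1P[-> | /wint //]; apply: wins_first_zero.
Qed.

Lemma response_test_gadd_loses_first p A t : dicotic A ->
  (forall C, C \in opts (opponent p) A ->
     exists2 Y, Y \in t & ~~ wins_first (opponent p) (C + Y)) ->
  ~~ wins_first (opponent p) (A + response_test p A t).
Proof.
move=> dA refute; apply/loses_firstP; rewrite opponentK; split.
  by case/opts_gadd_nil; rewrite opts_mkgame_opponent.
move=> Y /mem_opts_gadd[] [C CA ->].
  have [Z Zt nZ] := refute C CA; apply: wins_first_opt nZ.
  by apply: opts_gaddr; rewrite opts_mkgame inE Zt orbT.
move: CA; rewrite opts_mkgame_opponent inE => /eqP->.
apply: wins_first_opt (adjoint_loses_first (opponent p) dA).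
by apply: opts_gaddr; rewrite opts_mkgame mem_head.
Qed.

Lemma zero_pge_response p J A : dicotic J -> zero >=[p] J -> A \in opts p J ->
  exists2 C, C \in opts (opponent p) A & zero >=[p] C.
Proof.
move=> dJ J0 AJ; apply: NNPP => no_response; have dA := dicotic_opt dJ AJ.
have /fin_all_exists2[test dtest testP] (C : seq_sub (opts (opponent p) A)) :
    exists2 Y, dicotic Y &
      wins_first (opponent p) Y /\ ~~ wins_first (opponent p) (ssval C + Y).
  apply: not_zero_pge_test (dicotic_opt dA (ssvalP C)) _ => C0.
  by apply: no_response; exists (ssval C); first exact: ssvalP.
pose X := response_test p A (codom test).
have dX : dicotic X.
  by apply: dicotic_response_test dA _ => Y /codomP[C ->].
have loseX : ~~ wins_first p X.
  by apply: response_test_loses_first => Y /codomP[C ->]; case: (testP C).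
have loseAX : ~~ wins_first (opponent p) (A + X).
  apply: response_test_gadd_loses_first dA _ => C CA.
  by exists (test (SeqSub CA)); [apply: codom_f | case: (testP (SeqSub CA))].
have /(J0 X dX).1 := wins_first_opt (opts_gaddl X AJ) loseAX.
by rewrite gadd0g (negPf loseX).
Qed.

(** * Self-differences *)

Definition selfdiff_P_free (G : game) : Prop :=
  forall F, follower G F -> outcome (F - F) <> OP.

Lemma selfdiff_P_free_opt p G A :
  selfdiff_P_free G -> A \in opts p G -> selfdiff_P_free A.
Proof.
by move=> freeG AG F AF; apply/freeG/(follower_trans (follower_opt AG) AF).
Qed.

Lemma selfdiff_P_freeI G : outcome (G - G) <> OP ->
  (forall p A, A \in opts p G -> selfdiff_P_free A) -> selfdiff_P_free G.
Proof.
by move=> nP free F /follower_cases[-> // | [p [A AG]]]; apply: free AG F.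
Qed.

Lemma selfdiff_P_free_same_star A : same A star -> selfdiff_P_free A.
Proof.
move=> sA; apply: selfdiff_P_freeI.
  by rewrite (same_outcome (same_gadd sA (same_gneg sA))).
move=> p X /(same_opt sA)[Y]; rewrite opts_star inE => /eqP-> /same_zero->.
by apply: selfdiff_P_freeI => // q Z; rewrite opts_zero.
Qed.

Lemma selfdiff_pge_zero p G :
  dicotic G -> selfdiff_P_free G -> G - G >=[p] zero.
Proof.
elim/game_opts_ind: G => G IH dG freeG.
have IHG q A : A \in opts q G -> A - A >=[p] zero.
  by move=> AG; apply: IH AG (dicotic_opt dG AG) (selfdiff_P_free_opt freeG AG).
have win q : wins_first q (G - G).
  exact/outcome_gadd_gneg_not_P/freeG/follower_refl.
apply: covers_pge; first exact: dicotic_gadd dG (dicotic_gneg dG).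
- exact: dicotic_zero.
- by split=> [|A]; rewrite ?opts_zero.
split=> [_ | A /mem_opts_gadd[] [B BG ->]]; first exact: wins_first_zero.
  right; exists (B - B); last by apply/pge_opponent; apply: IHG BG.
  by apply: opts_gaddr; rewrite opts_gneg opponentK map_f.
move: BG; rewrite opts_gneg opponentK => /mapP[C CG ->].
right; exists (C - C); last by apply/pge_opponent; apply: IHG CG.
by apply: opts_gaddl; rewrite opponentK.
Qed.

Lemma selfdiff_P_free_gneg_pge p G K : dicotic G -> dicotic K ->
  selfdiff_P_free G -> zero >=[p] G + K -> - G >=[p] K.
Proof.
move=> dG dK freeG GK_le0.
apply: (@pge_cancel p K (- G) G) => //; first exact: dicotic_gneg.
  exact: pge_trans GK_le0 (pge_gaddC _ _ _).
exact: pge_trans (pge_gaddC _ _ _) (selfdiff_pge_zero p dG freeG).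
Qed.

Lemma opts_selfdiff_P_free_gneg_pge p G K : dicotic G -> dicotic K ->
  (forall q A, A \in opts q G -> selfdiff_P_free A) ->
  zero >=[p] G + K -> - G >=[p] K.
Proof.
move=> dG + free; elim/game_opts2_ind: K => K IH dK GK_le0.
have respond X (XGK : X \in opts _ (G + K)) :=
  zero_pge_response (dicotic_gadd dG dK) GK_le0 XGK.
apply: covers_pge => //; first exact: dicotic_gneg; split.
- move=> K0; rewrite K0 gaddg0 in GK_le0.
  by rewrite wins_first_gneg; apply: zero_pge_wins_first.
- move=> A AK; have dA := dicotic_opt dK AK.
  have [X] := respond _ (opts_gaddr G AK).
  case/mem_opts_gadd=> [[B BG ->] | [B BA ->]] B_le0.
    left; exists (- B); first by rewrite opts_gneg map_f.
    exact: selfdiff_P_free_gneg_pge (dicotic_opt dG BG) dA (free _ _ BG) B_le0.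
  by right; exists B => //; apply: IH AK BA (dicotic_opt dA BA) B_le0.
- move=> /gneg_eq0 G0; rewrite G0 gadd0g in GK_le0.
  exact: zero_pge_wins_first.
move=> NA; rewrite opts_gneg opponentK => /mapP[A AG ->].
have dA := dicotic_opt dG AG; have freeA := free _ _ AG.
have [X] := respond _ (opts_gaddl K AG).
case/mem_opts_gadd=> [[B BA ->] | [B BK ->]] B_le0.
  right; exists (- B); first by rewrite opts_gneg opponentK map_f.
  apply/pge_opponent/(selfdiff_P_free_gneg_pge (dicotic_opt dA BA) dK _ B_le0).
  exact: selfdiff_P_free_opt freeA BA.
left; exists B => //; apply/pge_opponent.
exact: selfdiff_P_free_gneg_pge dA (dicotic_opt dK BK) freeA B_le0.
Qed.

(** * Options of invertible games *)

Definition share_inverse (p : player) (A B : game) : Prop :=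
  exists E, [/\ dicotic E, zero >=[p] A + E & B + E >=[p] zero].

Lemma share_inverse_pge p A B :
  dicotic A -> dicotic B -> share_inverse p A B -> B >=[p] A.
Proof. by move=> dA dB [E [_ AE BE]]; apply: pge_cancel AE BE. Qed.

Lemma share_inverse_same_invertible p A B :
  share_inverse p A B -> same A B -> invertible A.
Proof.
move=> [E [dE AE BE]] sAB; exists E; split=> //; apply/(deq_pge p); split=> //.
exact: pge_trans (pge_same _ (same_gadd sAB (same_refl E))) BE.
Qed.

(* The descent in [K] alternates replies in [G + K] and in [A + D] until one of
   them falls in [G] or in [A]. *)
Lemma reply_reversible_or_share_inverse p G A K D : dicotic G -> dicotic K ->
  A \in opts p G -> D \in opts (opponent p) K ->
  G + K >=[p] zero -> zero >=[p] A + D ->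
  reversible p G A \/ exists2 B, B \in opts p G & share_inverse p A B.
Proof.
move=> dG + AG; have dA := dicotic_opt dG AG.
elim/game_opts2_ind: K D => K IH D dK DK /pge_opponent GK_ge0 AD_le0.
have dD := dicotic_opt dK DK.
have [X] := zero_pge_response (dicotic_gadd dG dK) GK_ge0 (opts_gaddr G DK).
rewrite opponentK => /mem_opts_gadd[[B BG ->] | [E ED ->]] /pge_opponent.
  by move=> BD_ge0; right; exists B => //; exists D.
move=> GE_ge0; have dE := dicotic_opt dD ED.
have [Y] := zero_pge_response (dicotic_gadd dA dD) AD_le0 (opts_gaddr A ED).
case/mem_opts_gadd=> [[C CA ->] CE_le0 | [F FE ->] AF_le0].
  left; exists C => //.
  exact: pge_cancel (dicotic_opt dA CA) dG CE_le0 GE_ge0.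
exact: IH DK ED F dE FE GE_ge0 AF_le0.
Qed.

Lemma invertible_opt p G A : dicotic G -> invertible G -> A \in opts p G ->
  reversible p G A \/ exists2 B, B \in opts p G & share_inverse p A B.
Proof.
move=> dG [H [dH /(deq_pge p)[GH_ge0 GH_le0]]] AG; have dA := dicotic_opt dG AG.
have [X] := zero_pge_response (dicotic_gadd dG dH) GH_le0 (opts_gaddl H AG).
case/mem_opts_gadd=> [[C CA ->] CH_le0 | [D DH ->] AD_le0].
  left; exists C => //.
  exact: pge_cancel (dicotic_opt dA CA) dG CH_le0 GH_ge0.
exact: reply_reversible_or_share_inverse DH GH_ge0 AD_le0.
Qed.

(** * Canonical forms *)

Lemma reduces_dominated p G A B :
  A \in opts p G -> B \in opts p G -> ~~ same A B -> B >=[p] A ->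
  reduces G (mkgame p (remove A (opts p G)) (opts (opponent p) G)).
Proof.
case: p => AG BG nAB BA.
  exact/(dominated_left AG BG nAB)/dge_pge_left.
exact/(dominated_right AG BG nAB)/dge_pge_right.
Qed.

Lemma reduces_nonatomic p G A B :
  A \in opts p G -> B \in opts (opponent p) A -> G >=[p] B ->
  opts p B <> [::] ->
  reduces G (mkgame p (opts p B ++ remove A (opts p G)) (opts (opponent p) G)).
Proof.
case: p => AG BA GB nB.
  by apply: nonatomic_left AG BA _ nB; apply/dge_pge_left.
by apply: nonatomic_right AG BA _ nB; apply/dge_pge_right.
Qed.

Lemma reduces_atomic p G A :
  A \in opts p G -> zero \in opts (opponent p) A -> G >=[p] zero ->
  exists2 s, {subset s <= star :: remove A (opts p G)} &
    reduces G (mkgame p s (opts (opponent p) G)).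
Proof.
case: p => AG A0 G0.
  exists (if has (fun X => ~~ wins_first Right X) (remove A (lopts G))
          then remove A (lopts G) else star :: remove A (lopts G)).
    by case: ifP => _ //; apply/mem_subseq/subseq_cons.
  by apply: atomic_left AG _; split=> //; apply/dge_pge_left.
exists (if has (fun X => ~~ wins_first Left X) (remove A (ropts G))
        then remove A (ropts G) else star :: remove A (ropts G)).
  by case: ifP => _ //; apply/mem_subseq/subseq_cons.
by apply: atomic_right AG _; split=> //; apply/dge_pge_right.
Qed.

Lemma mem_remove_same A X s : X \in remove A s -> same X A = false.
Proof. by rewrite mem_filter => /andP[/negPf]. Qed.

Lemma canonical_opt p G A : canonical G -> A \in opts p G -> canonical A.
Proof.
by move=> cG AG F F' AF; apply: cG; apply: follower_trans (follower_opt AG) AF.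
Qed.

Lemma canonical_reduces_opt p G A s : canonical G -> A \in opts p G ->
  reduces G (mkgame p s (opts (opponent p) G)) -> exists2 X, X \in s & same X A.
Proof.
move=> cG AG /(cG _ _ (follower_refl G)) sGG'.
have [X] := same_opt (same_sym sGG') AG.
by rewrite opts_mkgame => Xs /same_sym; exists X.
Qed.

Lemma canonical_dominated_same p G A B : canonical G ->
  A \in opts p G -> B \in opts p G -> B >=[p] A -> same A B.
Proof.
move=> cG AG BG BA; apply: contraT => nAB.
have [X] := canonical_reduces_opt cG AG (reduces_dominated AG BG nAB BA).
by move=> /mem_remove_same ->.
Qed.

Lemma canonical_reversible_same_star p G A : dicotic G -> canonical G ->
  A \in opts p G -> reversible p G A -> same A star.
Proof.
move=> dG cG AG [B BA GB]; have dB := dicotic_opt (dicotic_opt dG AG) BA.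
have [nilB | /nilP nB] := boolP (nilp (opts p B)); last first.
  have [X] := canonical_reduces_opt cG AG (reduces_nonatomic AG BA GB nB).
  by rewrite mem_cat => /orP[/(same_opts2F BA) | /mem_remove_same] ->.
have B0 := dicotic_opts_nil dB (nilP nilB); rewrite B0 in BA GB.
have [s sub_s redG] := reduces_atomic AG BA GB.
have [X /sub_s] := canonical_reduces_opt cG AG redG.
by rewrite inE => /predU1P[-> /same_sym | /mem_remove_same ->].
Qed.

Lemma canonical_invertible_selfdiff_P_free G :
  dicotic G -> canonical G -> invertible G -> selfdiff_P_free G.
Proof.
elim/game_opts_ind: G => G IH dG cG iG.
have free p A : A \in opts p G -> selfdiff_P_free A.
  move=> AG; have dA := dicotic_opt dG AG.
  have [revA | [B BG shareAB]] := invertible_opt dG iG AG.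
    apply: selfdiff_P_free_same_star.
    exact: canonical_reversible_same_star dG cG AG revA.
  have BA := share_inverse_pge dA (dicotic_opt dG BG) shareAB.
  have sAB := canonical_dominated_same cG AG BG BA.
  have iA := share_inverse_same_invertible shareAB sAB.
  exact: IH AG dA (canonical_opt cG AG) iA.
apply: selfdiff_P_freeI => //.
have [H [dH /(deq_pge Left)[GH_ge0 GH_le0]]] := iG.
have NG_ge_H := opts_selfdiff_P_free_gneg_pge dG dH free GH_le0.
apply/(outcome_gadd_gneg_not_P Left)/pge_zero_wins_first.
exact: pge_trans (pge_gadd2l dG NG_ge_H) GH_ge0.
Qed.

Lemma selfdiff_P_free_invertible G :
  dicotic G -> selfdiff_P_free G -> invertible G.
Proof.
move=> dG freeG; exists (- G); split; first exact: dicotic_gneg.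
apply/(deq_pge Left); split; first exact: selfdiff_pge_zero.
by apply/(pge_opponent Left); apply: selfdiff_pge_zero.
Qed.

Theorem mainTheorem2 (G : game) (dG : dicotic G) (cG : canonical G) :
  invertible G <->
  ~ (exists G', follower G G' /\ outcome (gadd G' (gneg G')) = OP).
Proof.
split=> [iG [F [GF PF]] | noP].
  exact: canonical_invertible_selfdiff_P_free dG cG iG F GF PF.
by apply: selfdiff_P_free_invertible dG _ => F GF PF; apply: noP; exists F.
Qed.
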